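(* For $\lambda\in(0,1)$ and $r\in[-1,1]\setminus\{0\}$, define $f_{r,\lambda}(x)=[1-\lambda+\lambda x^r]^{1/r}$. Let $T=U|T|\in\mathcal{M}_m(\mathbb{C})$ be the polar decomposition of an invertible centered matrix. If $U=V^*\,\mathrm{diag}(\alpha_1,\dots,\alpha_m)\,V$ with $V$ unitary and $\alpha_i\ne\alpha_j$ for $i\ne j$, then $$\lim_{n\to\infty}\Delta_{f_{r,\lambda}}^n(T)=U\bigl[V^*\bigl(I\circ V|T|^rV^*\bigr)V\bigr]^{1/r},$$ where $X\circ Y$ denotes the Hadamard (entrywise) product of matrices $X$ and $Y$. Especially, if $r=1$, the assumption that $T$ is centered can be removed.
   Context: $\mathcal{M}_m(\mathbb{C})$ is the set of $m\times m$ complex matrices, $|T|=(T^*T)^{1/2}$; for invertible $T$ the factor $U$ in $T=U|T|$ is unitary. The functions $f=f_{r,\lambda}$ are representing functions of operator means (power means). Induced Aluthge transformation of an invertible matrix $T=U|T|$ with $|T|=\sum_i s_iE_i$ ($s_i$ distinct eigenvalues, $E_i$ spectral projections): $\Delta_f(T)=\sum_{i,j}s_i f(s_j/s_i)\,E_iUE_j$. For $r=1$ this is $(1-\lambda)|T|U+\lambda U|T|$. Iterates: $\Delta_f^0(T)=T$, $\Delta_f^n(T)=\Delta_f(\Delta_f^{n-1}(T))$. $T=U|T|$ is centered if $\{U^{*m}|T|U^m,\ |T|,\ U^n|T|U^{*n}: n,m=1,2,\dots\}$ is a commuting set. *)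

(* Defs.v *)
From mathcomp Require Import all_boot all_order all_algebra.
From mathcomp Require Import complex spectral.
From mathcomp Require Import all_classical all_reals all_analysis.

Set Implicit Arguments.
Unset Strict Implicit.
Unset Printing Implicit Defensive.

Import Order.TTheory GRing.Theory Num.Theory.
Import numFieldNormedType.Exports.

Local Open Scope classical_set_scope.
Local Open Scope ring_scope.
Local Open Scope complex_scope.
Local Open Scope sesquilinear_scope.

(* The complex numbers, packaged as a numClosedFieldType so that the spectral
   theory of matrices and the norm topology are both inferred on matrices. *)
Definition Cplx (R : realType) : numClosedFieldType := R[i].

Section InducedAluthge.
Context {R : realType} {m : nat}.
Local Notation C := (Cplx R).

Definition toC (x : R) : C := x%:C.

(* Meant for Hermitian A: the duplicate-free list of its (real) eigenvalues. *)
Definition spectrum (A : 'M[C]_m) : seq R :=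
  undup [seq complex.Re (spectral_diag A 0 i) | i : 'I_m].

(* The orthogonal projection onto the eigenspace of A for s. MathComp matrices
   act on row vectors; for Hermitian A this is the same projection as for the
   action on column vectors. *)
Definition spectral_proj (A : 'M[C]_m) (s : R) : 'M[C]_m :=
  proj_ortho (eigenspace A (toC s)).

(* Functional calculus g(A) = sum_s g(s) E_s of a Hermitian matrix A. *)
Definition mxfun (g : R -> R) (A : 'M[C]_m) : 'M[C]_m :=
  \sum_(s <- spectrum A) toC (g s) *: spectral_proj A s.

Definition mxpow (A : 'M[C]_m) (p : R) : 'M[C]_m :=
  mxfun (fun x => x `^ p) A.

Definition mxabs (T : 'M[C]_m) : 'M[C]_m := mxpow (T^t* *m T) 2^-1.

(* For invertible T, the only U such that T = U |T|. *)
Definition polar_factor (T : 'M[C]_m) : 'M[C]_m := T *m invmx (mxabs T).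

Definition aluthge (f : R -> R) (T : 'M[C]_m) : 'M[C]_m :=
  \sum_(s <- spectrum (mxabs T)) \sum_(t <- spectrum (mxabs T))
    toC (s * f (t / s)) *:
      (spectral_proj (mxabs T) s *m polar_factor T *m
       spectral_proj (mxabs T) t).

Definition aluthge_iter (f : R -> R) (n : nat) (T : 'M[C]_m) : 'M[C]_m :=
  iter n (aluthge f) T.

Definition centered_family (T : 'M[C]_m) : set 'M[C]_m :=
  let U := polar_factor T in
  [set mxabs T] `|`
  [set (U^t* ^+ k *m mxabs T *m U ^+ k) | k in [set k : nat | (0 < k)%N]] `|`
  [set (U ^+ k *m mxabs T *m U^t* ^+ k) | k in [set k : nat | (0 < k)%N]].

Definition centered (T : 'M[C]_m) : Prop :=
  forall A B, centered_family T A -> centered_family T B ->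
    A *m B = B *m A.

Definition hadamard (A B : 'M[C]_m) : 'M[C]_m :=
  map2_mx *%R A B.

End InducedAluthge.

(* The representing function of the power mean. *)
Definition power_mean_fun {R : realType} (r lambda x : R) : R :=
  (1 - lambda + lambda * x `^ r) `^ r^-1.

(* Main.v *)
Require Import Defs.
From HB Require Import structures.
From mathcomp Require Import all_boot all_order all_algebra.
From mathcomp Require Import complex spectral.
From mathcomp Require Import all_classical all_reals all_analysis.
From mathcomp Require Import ring.

Set Implicit Arguments.
Unset Strict Implicit.
Unset Printing Implicit Defensive.

Import Order.TTheory GRing.Theory Num.Theory.
Import numFieldNormedType.Exports.

Local Open Scope classical_set_scope.
Local Open Scope ring_scope.
Local Open Scope sesquilinear_scope.

(** Write T = U|T| and, for a positive definite X, let
    Phi(X) = (1 - l) U^t* X U + l X.  Both cases rest on the identity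
      Delta^n(U|T|) = U (Phi^n(|T|^r))^(1/r),
    which turns the iteration into a linear one.

    The transformation acts as a Schur multiplier (aluthge_schur): in an
    eigenbasis of Q with eigenvalues q_i it multiplies the (i, j) entry of the
    unitary U by q_i f(q_j / q_i), which for the power mean is
    ((1 - l) q_i^r + l q_j^r)^(1/r) (power_mean_kernel).  For r = 1 this kernel
    is (1 - l) q_i + l q_j, and Delta(UQ) = (1 - l) QU + l UQ = U Phi(Q)
    (aluthge_arithmetic).  For other r, suppose that Q and U^t* Q U are
    diagonal in the same basis, with entries q_i and q'_i.  Then
    QU = U(U^t* Q U) says that q_i = q'_j wherever the (i, j) entry of U is
    nonzero, so the multiplier there depends on j only and Delta(UQ) = U Q1,
    with Q1 diagonal of entries ((1 - l) q'_j^r + l q_j^r)^(1/r), that is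
    Q1^r = Phi(Q^r) (aluthge_commuting, aluthge_power_mean).  To iterate, all
    the matrices U^t*^k |T| U^k must be diagonal in one basis.  When T is centered they
    commute, and a commuting sequence of Hermitian matrices is diagonalizable
    by one unitary because finitely many of them span the others
    (simultaneous_diag).

    In the basis V that diagonalizes U, Phi multiplies the (i, j) entry by
    (1 - l) conj(alpha_i) alpha_j + l.  This is 1 for i = j and has modulus less
    than 1 otherwise, by strict convexity of the disc, so Phi^n(X) tends to the
    diagonal part of X in that basis (cvg_conj_avg).  That limit is positive
    definite with X.  For r = 1 nothing else is needed.  In the centered case
    all Phi^n(|T|^r) are diagonal in one fixed basis, hence so is their limit,
    and the power 1/r passes to the limit entry by entry (cvg_mxpow_udiag). *)

(** * Real scalars among the complex numbers *)

Section RealScalars.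
Variable R : realType.
Implicit Types x y : R.

Lemma toC_is_additive : zmod_morphism (@toC R).
Proof. exact: (raddfB (real_complex R)). Qed.

Lemma toC_is_multiplicative : monoid_morphism (@toC R).
Proof.
by split; [exact: (rmorph1 (real_complex R))|exact: (rmorphM (real_complex R))].
Qed.

HB.instance Definition _ :=
  GRing.isZmodMorphism.Build R (Cplx R) (@toC R) toC_is_additive.
HB.instance Definition _ :=
  GRing.isMonoidMorphism.Build R (Cplx R) (@toC R) toC_is_multiplicative.

Lemma toCK : cancel (@toC R) (@complex.Re R).
Proof. by []. Qed.

Lemma conj_toC x : (toC x)^* = toC x.
Proof. exact: conjc_real. Qed.

Lemma ltr_toC x y : (toC x < toC y) = (x < y).
Proof. exact: ltcR. Qed.

Lemma ler_toC x y : (toC x <= toC y) = (x <= y).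
Proof. exact: lecR. Qed.

Lemma norm_toC x : `|toC x| = toC `|x|.
Proof.
have [x0|x0] := leP 0 x; last first.
  by rewrite !ltr0_norm ?rmorphN// -(rmorph0 (@toC R)) ltr_toC.
by rewrite !ger0_norm// -(rmorph0 (@toC R)) ler_toC.
Qed.

Lemma real_toC (z : Cplx R) : z \is Num.real -> z = toC (complex.Re z).
Proof. by move=> /complex_realP [x ->]. Qed.

Lemma gt0_toC (z : Cplx R) : 0 < z -> exists2 x : R, 0 < x & z = toC x.
Proof.
move=> z0; exists (complex.Re z); last exact/real_toC/gtr0_real.
by rewrite -ltr_toC -real_toC ?gtr0_real// rmorph0.
Qed.

End RealScalars.

(** * Unitary diagonalization *)

Section Conjugate.
Variables (C : numClosedFieldType) (m : nat).
Implicit Types (A B : 'M[C]_m).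

Lemma adjmxM n p q (A : 'M[C]_(n, p)) (B : 'M[C]_(p, q)) :
  (A *m B)^t* = B^t* *m A^t*.
Proof. by rewrite trmx_mul map_mxM. Qed.

Lemma adjmxD A B : (A + B)^t* = A^t* + B^t*.
Proof. by rewrite linearD map_mxD. Qed.

Lemma adjmxZ (c : C) A : (c *: A)^t* = c^* *: A^t*.
Proof. by rewrite linearZ map_mxZ. Qed.

Lemma adj_diag_mx (d : 'rV[C]_m) : (diag_mx d)^t* = diag_mx (map_mx Num.conj d).
Proof. by rewrite tr_diag_mx map_diag_mx. Qed.

Lemma unitary_mulV (W : 'M[C]_m) : W \is unitarymx -> W *m W^t* = 1%:M.
Proof. by move/unitarymxP. Qed.

Lemma unitary_mulVl (W : 'M[C]_m) : W \is unitarymx -> W^t* *m W = 1%:M.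
Proof. by move/unitarymxP/mulmx1C. Qed.

Lemma unitary_conj_eq (W A B : 'M[C]_m) : W \is unitarymx ->
  (A = W^t* *m B *m W) <-> (W *m A *m W^t* = B).
Proof.
move=> hW; split=> [->|<-].
  by rewrite !mulmxA unitary_mulV// mul1mx -mulmxA unitary_mulV// mulmx1.
by rewrite !mulmxA unitary_mulVl// mul1mx -mulmxA unitary_mulVl// mulmx1.
Qed.

Lemma unitary_expr (U : 'M[C]_m) k : U \is unitarymx -> U ^+ k \is unitarymx.
Proof.
move=> hU; elim: k => [|k IH]; last by rewrite exprS; exact: mul_unitarymx.
by rewrite expr0; apply/unitarymxP; rewrite mul1mx trmx1 map_mx1.
Qed.

Lemma adjmxX (U : 'M[C]_m) k : (U ^+ k)^t* = U^t* ^+ k.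
Proof.
elim: k => [|k IH]; first by rewrite !expr0 trmx1 map_mx1.
by rewrite exprSr exprS -IH; exact: adjmxM.
Qed.

(** The intertwiner of the two diagonalizations is invertible, so each of its
    rows has a nonzero entry, and there the two diagonals agree. *)
Lemma unitary_diag_entries (W V : 'M[C]_m) (a b : 'rV[C]_m) :
  W \is unitarymx -> V \is unitarymx ->
  W^t* *m diag_mx a *m W = V^t* *m diag_mx b *m V ->
  forall i, exists j, a 0 i = b 0 j.
Proof.
move=> hW hV eqWV i; pose M := W *m V^t*.
have hM : diag_mx a *m M = M *m diag_mx b.
  have := congr1 (fun X => W *m X *m V^t*) eqWV.
  rewrite !mulmxA unitary_mulV// mul1mx -!mulmxA unitary_mulV// mulmx1.
  by rewrite /M !mulmxA.
have Mu : M \is unitarymx by rewrite mul_unitarymx// trmxC_unitary.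
have [[j Mij]|M0] := pselect (exists j, M i j != 0).
  exists j.
  move/matrixP: hM => /(_ i j).
  rewrite mul_diag_mx mul_mx_diag [LHS]mxE [RHS]mxE mulrC.
  exact: mulfI.
have : (M *m M^t*) i i = 0.
  rewrite mxE big1// => j _; have [->|Mij] := eqVneq (M i j) 0.
    by rewrite mul0r.
  by case: M0; exists j.
by rewrite unitary_mulV// mxE eqxx => /eqP; rewrite oner_eq0.
Qed.

Implicit Types (W V X : 'M[C]_m) (a b : 'I_m -> C).

Definition cdiag W a : 'M[C]_m := W^t* *m diag_mx (\row_i a i) *m W.

Lemma eq_cdiag W a b : a =1 b -> cdiag W a = cdiag W b.
Proof.
by move=> ab; congr (_ *m diag_mx _ *m _); apply/rowP=> i; rewrite !mxE ab.
Qed.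

Lemma cdiag1 W : W \is unitarymx -> cdiag W (fun=> 1) = 1%:M.
Proof.
move=> hW; rewrite -(unitary_mulVl hW) /cdiag.
congr (_ *m _); rewrite -[RHS]mulmx1; congr (_ *m _).
by apply/matrixP => i j; rewrite !mxE.
Qed.

Lemma cdiagD W a b : cdiag W a + cdiag W b = cdiag W (fun i => a i + b i).
Proof.
rewrite /cdiag -mulmxDl -mulmxDr; congr (_ *m _ *m _).
by apply/matrixP => i j; rewrite !mxE -mulrnDl.
Qed.

Lemma cdiagZ W (c : C) a : c *: cdiag W a = cdiag W (fun i => c * a i).
Proof.
rewrite /cdiag scalemxAl scalemxAr; congr (_ *m _ *m _).
by apply/matrixP => i j; rewrite !mxE mulrnAr.
Qed.

Lemma cdiagM W a b : W \is unitarymx ->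
  cdiag W a *m cdiag W b = cdiag W (fun i => a i * b i).
Proof.
move=> hW; rewrite /cdiag !mulmxA -[_ *m W *m W^t*]mulmxA unitary_mulV// mulmx1.
congr (_ *m _); rewrite -mulmxA mulmx_diag; congr (_ *m diag_mx _).
by apply/rowP => i; rewrite !mxE.
Qed.

Lemma adj_cdiag W a : (cdiag W a)^t* = cdiag W (fun i => (a i)^*).
Proof.
rewrite /cdiag !adjmxM trmxCK adj_diag_mx mulmxA; congr (_ *m diag_mx _ *m _).
by apply/rowP=> i; rewrite !mxE.
Qed.

Lemma cdiag_conj (U W : 'M[C]_m) a :
  U^t* *m cdiag W a *m U = cdiag (W *m U) a.
Proof. by rewrite /cdiag adjmxM !mulmxA. Qed.

Lemma cdiag_mull W a : W \is unitarymx ->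
  W *m cdiag W a = diag_mx (\row_i a i) *m W.
Proof. by move=> hW; rewrite /cdiag !mulmxA unitary_mulV// mul1mx. Qed.

Lemma cdiag_mulr W a : W \is unitarymx ->
  cdiag W a *m W^t* = W^t* *m diag_mx (\row_i a i).
Proof. by move=> hW; rewrite /cdiag -!mulmxA unitary_mulV// mulmx1. Qed.

Lemma cdiag_entry W a i j : W \is unitarymx ->
  (W *m cdiag W a *m W^t*) i j = a i *+ (i == j).
Proof.
by move=> hW; rewrite cdiag_mull// -mulmxA unitary_mulV// mulmx1 !mxE.
Qed.

Lemma cdiag_sandwich_entry (U W : 'M[C]_m) a b i j : W \is unitarymx ->
  (W *m (cdiag W a *m U *m cdiag W b) *m W^t*) i j =
  a i * ((W *m U *m W^t*) i j * b j).
Proof.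
move=> hW.
have -> : W *m (cdiag W a *m U *m cdiag W b) *m W^t* =
    diag_mx (\row_i a i) *m (W *m U *m W^t* *m diag_mx (\row_i b i)).
  rewrite /cdiag !mulmxA unitary_mulV// mul1mx.
  by rewrite -[_ *m W *m W^t*]mulmxA unitary_mulV// mulmx1.
by rewrite mul_diag_mx mxE mul_mx_diag mxE [in LHS]mxE [X in _ * (_ * X)]mxE.
Qed.

Lemma cdiag_values W V a b : W \is unitarymx -> V \is unitarymx ->
  cdiag W a = cdiag V b -> forall i, exists j, a i = b j.
Proof.
move=> hW hV /(unitary_diag_entries hW hV) h i.
by have [j] := h i; rewrite !mxE; exists j.
Qed.

(** The right-hand side is a Hermitian idempotent whose rows are eigenvectors
    for s and whose complement is orthogonal to all of them; this determines
    the orthogonal projection. *)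
Lemma proj_eigenspace_cdiag W a (s : C) : W \is unitarymx ->
  proj_ortho (eigenspace (cdiag W a) s) = cdiag W (fun i => (a i == s)%:R).
Proof.
move=> hW; pose E := cdiag W (fun i => (a i == s)%:R).
rewrite -/E.
set S := eigenspace _ _.
have Esub : (E <= S)%MS.
  apply/eigenspaceP; rewrite cdiagM// cdiagZ; apply: eq_cdiag => i.
  by have [->|_] := eqVneq (a i) s; rewrite ?mul1r ?mulr1 ?mul0r ?mulr0.
have SE : S *m E = S.
  have hS : S *m cdiag W a = s *: S by apply/eigenspaceP.
  have hSW : (S *m W^t*) *m diag_mx (\row_i a i) = s *: (S *m W^t*).
    rewrite -mulmxA -cdiag_mulr// mulmxA hS; exact/esym/scalemxAl.
  rewrite /E /cdiag !mulmxA.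
  suff -> : S *m W^t* *m diag_mx (\row_i (a i == s)%:R) = S *m W^t*.
    by rewrite -mulmxA unitary_mulVl// mulmx1.
  apply/matrixP => i j; rewrite mul_mx_diag mxE.
  move/matrixP: hSW => /(_ i j); rewrite mul_mx_diag !mxE.
  have [_ _|ds] := eqVneq (a j) s; first by rewrite mulr1.
  move/eqP; rewrite mulrC -subr_eq0 -mulrBl mulf_eq0 subr_eq0 (negPf ds) /=.
  by move/eqP->; rewrite mul0r.
have idE : E *m proj_ortho S = E by rewrite proj_ortho_id.
have adjE : E^t* = E.
  rewrite adj_cdiag; apply: eq_cdiag => i.
  by case: (a i == s); rewrite ?conjC0 ?conjC1.
have idemE : E *m E = E.
  rewrite cdiagM//; apply: eq_cdiag => i.
  by case: (a i == s); rewrite ?mul0r ?mul1r.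
have orth : (1%:M - E) *m S^t* = 0.
  rewrite -[X in X^t*]SE adjmxM adjE mulmxA mulmxBl mul1mx idemE.
  by rewrite subrr mul0mx.
move/orthomx1P: orth => /proj_ortho_0.
by rewrite mulmxBl mul1mx idE => /eqP; rewrite subr_eq0 => /eqP.
Qed.

Lemma adj_hermsym (A : 'M[C]_m) : A^t* = A -> A \is hermsymmx.
Proof. by move=> hA; apply/is_hermitianmxP; rewrite expr0 scale1r hA. Qed.

Lemma spectral_cdiag (A : 'M[C]_m) : A^t* = A ->
  A = cdiag (spectralmx A) (spectral_diag A 0).
Proof.
move=> hA; have hs := adj_hermsym hA.
have /orthomx_spectralP e := hermitian_normalmx hs.
rewrite {1}e invmx_unitary ?spectral_unitarymx// /cdiag.
by congr (_ *m diag_mx _ *m _); apply/rowP => i; rewrite mxE.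
Qed.

Lemma spectral_diag_real (A : 'M[C]_m) i : A^t* = A ->
  spectral_diag A 0 i \is Num.real.
Proof.
move=> /adj_hermsym hs.
by have /mxOverP := hermitian_spectral_diag_real hs; exact.
Qed.

End Conjugate.

(** * Positive definite matrices *)

Section PositiveDefinite.
Variables (C : numClosedFieldType) (m : nat).
Implicit Types (U W V X Q : 'M[C]_m) (a b : 'I_m -> C).

Definition posdef X :=
  X^t* = X /\ forall v : 'rV_m, v != 0 -> 0 < (v *m X *m v^t*) 0 0.

(** Evaluating the quadratic form in coordinates of the eigenbasis reduces
    positivity to positivity of the eigenvalues. *)
Lemma herm_form_cdiag (v : 'rV[C]_m) W a :
  (v *m cdiag W a *m v^t*) 0 0 = \sum_i a i * `|(v *m W^t*) 0 i| ^+ 2.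
Proof.
rewrite /cdiag !mulmxA -mulmxA -[W *m _]trmxCK adjmxM trmxCK.
rewrite mxE; apply: eq_bigr => i _.
by rewrite mul_mx_diag !mxE normCK -!mulrA mulrCA mulrA.
Qed.

Lemma posdef_cdiag W a : W \is unitarymx -> (forall i, 0 < a i) ->
  posdef (cdiag W a).
Proof.
move=> hW a0; split.
  by rewrite adj_cdiag; apply: eq_cdiag => i; rewrite geC0_conj// ltW.
move=> v v0; rewrite herm_form_cdiag.
have : v *m W^t* != 0.
  apply: contra_neq v0 => v0.
  by rewrite -(mulmx1 v) -(unitary_mulVl hW) mulmxA v0 mul0mx.
move=> /rV0Pn[i vi]; rewrite (bigD1 i)//= ltr_wpDr//.
  by apply: sumr_ge0 => j _; apply: mulr_ge0; [rewrite ltW | exact: exprn_ge0].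
by rewrite mulr_gt0 ?exprn_gt0 ?normr_gt0.
Qed.

Lemma posdef_entry W X i : W \is unitarymx -> posdef X ->
  0 < (W *m X *m W^t*) i i.
Proof.
move=> hW [_ pX].
have -> : (W *m X *m W^t*) i i = (row i W *m X *m (row i W)^t*) 0 0.
  by rewrite -row_mul !mxE; apply: eq_bigr => k _; rewrite !mxE.
apply: pX; apply/eqP => r0; have /row_unitarymxP/(_ i i) := hW.
by rewrite r0 eqxx dotmxE mul0mx mxE => /eqP; rewrite eq_sym oner_eq0.
Qed.

Lemma posdef_cdiag_gt0 W a : posdef (cdiag W a) -> W \is unitarymx ->
  forall i, 0 < a i.
Proof.
move=> pX hW i; have := posdef_entry i hW pX.
by rewrite cdiag_entry// eqxx.
Qed.

Lemma posdefD X Q : posdef X -> posdef Q -> posdef (X + Q).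
Proof.
move=> [hX pX] [hQ pQ]; split; first by rewrite adjmxD hX hQ.
by move=> v v0; rewrite mulmxDr mulmxDl mxE addr_gt0 ?pX ?pQ.
Qed.

Lemma posdefZ (c : C) X : 0 < c -> posdef X -> posdef (c *: X).
Proof.
move=> c0 [hX pX]; split; first by rewrite adjmxZ hX geC0_conj// ltW.
by move=> v v0; rewrite -scalemxAr -scalemxAl mxE mulr_gt0 ?pX.
Qed.

Lemma posdef_congr (S : 'M[C]_m) X : S \in unitmx -> posdef X ->
  posdef (S^t* *m X *m S).
Proof.
move=> uS [hX pX]; split; first by rewrite !adjmxM hX trmxCK mulmxA.
move=> v v0.
have -> : v *m (S^t* *m X *m S) *m v^t* =
    (v *m S^t*) *m X *m (v *m S^t*)^t* by rewrite adjmxM trmxCK !mulmxA.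
apply: pX; apply: contra_neq v0 => v0.
suff uS' : S^t* \in unitmx by rewrite -(mulmxK uS' v) v0 mul0mx.
by rewrite map_unitmx unitmx_tr.
Qed.

Lemma posdef1 : posdef 1%:M.
Proof.
have h1 : (1%:M : 'M[C]_m) \is unitarymx.
  by apply/unitarymxP; rewrite mul1mx trmx1 map_mx1.
by rewrite -(cdiag1 h1); apply: posdef_cdiag.
Qed.

Lemma posdef_unitmx X : posdef X -> X \in unitmx.
Proof.
move=> [_ pX]; rewrite -row_free_unit; apply: inj_row_free => v vX.
by apply/eqP; apply: contraT => /pX; rewrite vX mul0mx mxE ltxx.
Qed.

End PositiveDefinite.

(** * Functional calculus and polar decomposition *)

Section Calculus.
Variables (R : realType) (m : nat).
Local Notation C := (Cplx R).
Implicit Types (U W V X Q : 'M[C]_m) (d e q : 'I_m -> R).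

Definition udiag W d : 'M[C]_m := cdiag W (fun i => toC (d i)).

Lemma eq_udiag W d e : d =1 e -> udiag W d = udiag W e.
Proof. by move=> de; apply: eq_cdiag => i; rewrite de. Qed.

Lemma adj_udiag W d : (udiag W d)^t* = udiag W d.
Proof. by rewrite adj_cdiag; apply: eq_cdiag => i; exact: conj_toC. Qed.

Lemma udiagM W d e : W \is unitarymx ->
  udiag W d *m udiag W e = udiag W (fun i => d i * e i).
Proof.
move=> hW; rewrite /udiag (cdiagM _ _ hW).
by apply: eq_cdiag => i; rewrite rmorphM.
Qed.

Lemma udiag_conj U W d : U^t* *m udiag W d *m U = udiag (W *m U) d.
Proof. exact: cdiag_conj. Qed.

Lemma herm_udiag X : X^t* = X -> exists W d, W \is unitarymx /\ X = udiag W d.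
Proof.
move=> hX; exists (spectralmx X), (fun i => complex.Re (spectral_diag X 0 i)).
split; first exact: spectral_unitarymx.
rewrite {1}(spectral_cdiag hX); apply: eq_cdiag => i.
exact/real_toC/spectral_diag_real.
Qed.

Lemma posdef_udiagP X : posdef X <-> exists W d,
  [/\ W \is unitarymx, forall i, 0 < d i & X = udiag W d].
Proof.
split=> [pX|[W [d [hW d0 ->]]]].
  have [W [d [hW eX]]] := herm_udiag pX.1.
  exists W, d; split => // i; rewrite -ltr_toC rmorph0.
  by rewrite eX in pX; exact: (posdef_cdiag_gt0 pX hW i).
by apply: posdef_cdiag => // i; rewrite -(rmorph0 (@toC R)) ltr_toC.
Qed.

Lemma posdef_udiag_gt0 W d : posdef (udiag W d) -> W \is unitarymx ->
  forall i, 0 < d i.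
Proof.
move=> pX hW i; rewrite -ltr_toC rmorph0.
exact: (posdef_cdiag_gt0 pX hW i).
Qed.

Lemma spectral_proj_udiag W d (s : R) : W \is unitarymx ->
  spectral_proj (udiag W d) s = cdiag W (fun i => (d i == s)%:R).
Proof.
move=> hW; rewrite /spectral_proj /udiag (proj_eigenspace_cdiag _ _ hW).
by apply: eq_cdiag => i; rewrite (can_eq (@toCK R)).
Qed.

Lemma mem_spectrum_udiag W d s : W \is unitarymx ->
  reflect (exists i, s = d i) (s \in spectrum (udiag W d)).
Proof.
move=> hW; rewrite /spectrum mem_undup.
have hX := adj_udiag W d; have e := spectral_cdiag hX.
apply: (iffP mapP) => [[i _ ->]|[i ->]].
  have [j ->] := cdiag_values (spectral_unitarymx _) hW (esym e) i.
  by exists j.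
have [j ej] := cdiag_values hW (spectral_unitarymx _) e i.
by exists j; rewrite ?mem_enum// -ej.
Qed.

Lemma sum_spectrum_delta W d (F : R -> C) i : W \is unitarymx ->
  \sum_(s <- spectrum (udiag W d)) (d i == s)%:R * F s = F (d i).
Proof.
move=> hW; rewrite (bigD1_seq (d i)) ?undup_uniq//=; last first.
  by apply/mem_spectrum_udiag => //; exists i.
rewrite eqxx mul1r big1 ?addr0// => s /negPf.
by rewrite eq_sym => ->; rewrite mul0r.
Qed.

Lemma mxfun_udiag W d (g : R -> R) : W \is unitarymx ->
  mxfun g (udiag W d) = udiag W (g \o d).
Proof.
move=> hW; apply/(unitary_conj_eq _ _ hW).
rewrite /mxfun mulmx_sumr mulmx_suml; apply/matrixP => i j; rewrite summxE !mxE.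
rewrite -(sum_spectrum_delta d (fun s => toC (g s) *+ (i == j)) i hW).
apply: eq_bigr => s _; rewrite (spectral_proj_udiag _ _ hW).
rewrite -scalemxAr -scalemxAl mxE (cdiag_entry _ _ _ hW).
by rewrite mulrnAr [RHS]mulrnAr [in LHS]mulrC.
Qed.

Lemma mxpow_udiag W d (p : R) : W \is unitarymx ->
  mxpow (udiag W d) p = udiag W (fun i => d i `^ p).
Proof. exact: mxfun_udiag. Qed.

Lemma mxfun_conj (g : R -> R) U X : U \is unitarymx -> X^t* = X ->
  mxfun g (U^t* *m X *m U) = U^t* *m mxfun g X *m U.
Proof.
move=> hU /herm_udiag[W [d [hW ->]]].
have hWU : W *m U \is unitarymx by exact: mul_unitarymx.
by rewrite udiag_conj (mxfun_udiag _ _ hW) (mxfun_udiag _ _ hWU) udiag_conj.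
Qed.

Lemma posdef_mxpow (r : R) X : posdef X -> posdef (mxpow X r).
Proof.
move=> /posdef_udiagP[W [d [hW d0 ->]]]; rewrite /mxpow (mxfun_udiag _ _ hW).
apply/posdef_udiagP; exists W, ((fun x => x `^ r) \o d).
by split=> // i; exact: powR_gt0.
Qed.

Lemma mxpow1 X : posdef X -> mxpow X 1 = X.
Proof.
move=> /posdef_udiagP[W [d [hW d0 ->]]]; rewrite /mxpow (mxfun_udiag _ _ hW).
by apply: eq_udiag => i /=; rewrite powRr1// ltW.
Qed.

Lemma mxpowK (r : R) X : r != 0 -> posdef X -> mxpow (mxpow X r) r^-1 = X.
Proof.
move=> r0 /posdef_udiagP[W [d [hW d0 ->]]].
rewrite /mxpow !(mxfun_udiag _ _ hW).
by apply: eq_udiag => i /=; rewrite -powRrM divff// powRr1// ltW.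
Qed.

Lemma posdef_mxabs X : X \in unitmx -> posdef (mxabs X).
Proof.
move=> uX; apply: posdef_mxpow; rewrite -[X^t*]mulmx1.
exact: posdef_congr uX (posdef1 _ _).
Qed.

Lemma mxabs_mul_unitary U Q : U \is unitarymx -> posdef Q -> mxabs (U *m Q) = Q.
Proof.
move=> hU /posdef_udiagP[W [q [hW q0 ->]]].
have -> : mxabs (U *m udiag W q) = mxpow (udiag W (fun i => q i * q i)) 2^-1.
  rewrite /mxabs adjmxM adj_udiag mulmxA.
  by rewrite -(mulmxA (udiag W q)) (unitary_mulVl hU) mulmx1 (udiagM _ _ hW).
rewrite /mxpow (mxfun_udiag _ _ hW); apply: eq_udiag => i /=.
by rewrite powR12_sqrt ?mulr_ge0 ?ltW// -expr2 sqrtr_sqr ger0_norm ?ltW.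
Qed.

Lemma polar_factor_mul_unitary U Q : U \is unitarymx -> posdef Q ->
  polar_factor (U *m Q) = U.
Proof.
move=> hU pQ; rewrite /polar_factor (mxabs_mul_unitary hU pQ) mulmxK //.
exact: posdef_unitmx.
Qed.

(** The spectral projections become diagonal 0-1 matrices in the eigenbasis, so
    the double sum keeps, at each entry, the term of its two eigenvalues: the
    transformation is a Schur multiplier. *)
Lemma aluthge_schur (f : R -> R) U W q : U \is unitarymx -> W \is unitarymx ->
  (forall i, 0 < q i) ->
  W *m aluthge f (U *m udiag W q) *m W^t* =
  \matrix_(i, j) (toC (q i * f (q j / q i)) * (W *m U *m W^t*) i j).
Proof.
move=> hU hW q0.
have pQ : posdef (udiag W q) by apply/posdef_udiagP; exists W, q.
rewrite /aluthge (mxabs_mul_unitary hU pQ) (polar_factor_mul_unitary hU pQ).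
rewrite mulmx_sumr mulmx_suml; apply/matrixP => i j; rewrite summxE.
rewrite [RHS]mxE; set M := (W *m U *m W^t*) i j.
rewrite -(sum_spectrum_delta q (fun s => toC (s * f (q j / s)) * M) i hW).
apply: eq_bigr => s _; rewrite mulmx_sumr mulmx_suml summxE.
rewrite -(sum_spectrum_delta q (fun t => toC (s * f (t / s)) * M) j hW).
rewrite mulr_sumr; apply: eq_bigr => t _.
rewrite !(spectral_proj_udiag _ _ hW) -scalemxAr -scalemxAl mxE.
rewrite (cdiag_sandwich_entry _ _ _ _ _ hW) -/M.
by rewrite [M * _]mulrC mulrCA; congr (_ * _); rewrite mulrCA.
Qed.

End Calculus.

(** * Averages of unitary conjugates *)

Section Averaging.
Variables (C : numClosedFieldType) (m : nat).
Implicit Types (U V W X : 'M[C]_m).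

(** The linear map whose iterates govern the r-th powers of the moduli; the
    weights will be c1 = 1 - l and c2 = l. *)
Definition conj_avg (c1 c2 : C) U X : 'M[C]_m :=
  c1 *: (U^t* *m X *m U) + c2 *: X.

Lemma posdef_conj_avg (c1 c2 : C) U X : 0 < c1 -> 0 < c2 -> U \is unitarymx ->
  posdef X -> posdef (conj_avg c1 c2 U X).
Proof.
move=> c1_0 c2_0 hU pX; apply: posdefD; apply: posdefZ => //.
by apply: posdef_congr => //; exact: unitarymx_unit.
Qed.

(** The left-hand side is the form in which the next iterate is written, the
    right-hand side the form that the arithmetic mean produces. *)
Lemma mulmx_conj_avg (c1 c2 : C) U X : U \is unitarymx ->
  U *m conj_avg c1 c2 U X = c1 *: (X *m U) + c2 *: (U *m X).
Proof.
by move=> hU; rewrite mulmxDr -!scalemxAr !mulmxA unitary_mulV// mul1mx.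
Qed.

Lemma sandwich_lin_entry (c1 c2 : C) W (A B : 'M[C]_m) i j :
  (W *m (c1 *: A + c2 *: B) *m W^t*) i j =
  c1 * (W *m A *m W^t*) i j + c2 * (W *m B *m W^t*) i j.
Proof.
rewrite mulmxDr mulmxDl -!scalemxAr -!scalemxAl mxE.
by congr (_ + _); rewrite mxE.
Qed.

(** Conjugation by a diagonal unitary multiplies each entry by a scalar, so the
    averaging is diagonal on matrix units in an eigenbasis of U. *)
Lemma conj_avg_entry (c1 c2 : C) U V X (alpha : 'rV[C]_m) n i j :
  V \is unitarymx -> U = V^t* *m diag_mx alpha *m V ->
  (V *m iter n (conj_avg c1 c2 U) X *m V^t*) i j =
  (c1 * ((alpha 0 i)^* * alpha 0 j) + c2) ^+ n * (V *m X *m V^t*) i j.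
Proof.
move=> hV eU; elim: n => [|n IH]; first by rewrite mul1r.
rewrite iterS; move: IH; set Y := iter n _ X => IH.
have eVUY : V *m (U^t* *m Y *m U) *m V^t* =
    diag_mx (map_mx Num.conj alpha) *m (V *m Y *m V^t*) *m diag_mx alpha.
  rewrite eU !adjmxM adj_diag_mx trmxCK !mulmxA unitary_mulV// mul1mx.
  by rewrite -[_ *m V *m V^t*]mulmxA unitary_mulV// mulmx1.
rewrite /conj_avg mulmxDr mulmxDl -!scalemxAr -!scalemxAl eVUY mxE.
rewrite [X in X + _]mxE [X in _ + X]mxE mul_mx_diag mxE mul_diag_mx mxE IH.
by rewrite mxE exprS; ring.
Qed.

Lemma unitary_diag_norm1 U V (alpha : 'rV[C]_m) i :
  U \is unitarymx -> V \is unitarymx -> U = V^t* *m diag_mx alpha *m V ->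
  `|alpha 0 i| = 1.
Proof.
move=> hU hV eU.
have eD : diag_mx alpha = V *m U *m V^t* by apply/esym/(unitary_conj_eq _ _ hV).
have uD : diag_mx alpha \is unitarymx.
  by rewrite eD !mul_unitarymx// trmxC_unitary.
move/unitary_mulV/matrixP/(_ i i): uD.
rewrite mul_diag_mx !mxE eqxx mulr1n -normCK => /eqP.
by rewrite sqrp_eq1// => /eqP.
Qed.

(** Strict convexity of the unit disc: the modulus squared of the average falls
    short of 1 by l(1 - l)|a - b|^2. *)
Lemma norm_conj_avg_lt1 (l a b : C) : 0 < l < 1 -> `|a| = 1 -> `|b| = 1 ->
  a != b -> `|(1 - l) * (a^* * b) + l| < 1.
Proof.
move=> /andP[l0 l1] na nb ab.
have lr : l^* = l by rewrite geC0_conj// ltW.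
have aa : a * a^* = 1 by rewrite -normCK na expr1n.
have bb : b * b^* = 1 by rewrite -normCK nb expr1n.
have dab : 0 < `|a - b| ^+ 2 by rewrite exprn_gt0// normr_gt0 subr_eq0.
rewrite -(@ltr_pXn2r _ 2) ?nnegrE// expr1n -subr_gt0.
suff -> : 1 - `|(1 - l) * (a^* * b) + l| ^+ 2 = l * (1 - l) * `|a - b| ^+ 2.
  by apply: mulr_gt0 => //; apply: mulr_gt0 => //; rewrite subr_gt0.
rewrite !normCK !(rmorphD, rmorphM, rmorphN, rmorph1) /= lr conjCK.
have -> : ((1 - l) * (a^* * b) + l) * ((1 - l) * (a * b^*) + l) =
    (1 - l) ^+ 2 * ((a * a^*) * (b * b^*)) +
    l * (1 - l) * (a^* * b + a * b^*) + l ^+ 2 by ring.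
have -> : (a - b) * (a^* - b^*) =
    a * a^* + b * b^* - (a^* * b + a * b^*) by ring.
by rewrite aa bb; ring.
Qed.

End Averaging.

(** * Simultaneous diagonalization of a sequence *)

Section Simultaneous.

(** The dimensions of the spans of the initial segments are bounded, so some
    segment has a span of maximal dimension; it then contains all later
    vectors. *)
Lemma nat_family_finite_span (F : fieldType) (n : nat) (x : nat -> 'rV[F]_n) :
  exists N, forall k, (x k <= \matrix_(j < N) x j)%MS.
Proof.
pose S N := \matrix_(j < N) x j.
pose P d := `[< exists N, \rank (S N) = d >].
have P0 : exists d, P d by exists (\rank (S 0%N)); apply/asboolP; exists 0%N.
have Pn d : P d -> (d <= n)%N by move/asboolP => [N <-]; exact: rank_leq_col.
case: (ex_maxnP P0 Pn) => d /asboolP[N rN] dmax; exists N => k.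
have sub N1 N2 : (N1 <= N2)%N -> (S N1 <= S N2)%MS.
  move=> le12; apply/row_subP => i; rewrite rowK.
  by rewrite -[x i](rowK (fun j : 'I_N2 => x j) (widen_ord le12 i)) row_sub.
have sNk : (x k <= S (maxn N k.+1))%MS.
  have ltk : (k < maxn N k.+1)%N by rewrite leq_max leqnn orbT.
  rewrite -[x k](rowK (fun j : 'I_(maxn N k.+1) => x j) (Ordinal ltk)).
  exact: row_sub.
apply: (submx_trans sNk).
rewrite -mxrank_leqif_sup ?sub ?leq_maxl// eqn_leq mxrankS ?sub ?leq_maxl//=.
by rewrite [leqRHS]rN; apply: dmax; apply/asboolP; exists (maxn N k.+1).
Qed.

Variables (C : numClosedFieldType) (m : nat).

(** A unitary that triangularizes Hermitian matrices diagonalizes them. Such a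
    unitary exists for finite commuting families; applied to finitely many A k
    that span the sequence, it diagonalizes all A k by linearity. *)
Lemma simultaneous_diag (A : nat -> 'M[C]_m) :
  (forall k, (A k)^t* = A k) -> (forall k l, A k *m A l = A l *m A k) ->
  exists2 W, W \is unitarymx & forall k, exists a, A k = cdiag W a.
Proof.
move=> hA cA; have [N spanA] := nat_family_finite_span (fun k => mxvec (A k)).
have [|W hW trigA] := cotrigonalization (As := [seq A k | k <- iota 0 N]).
  by move=> _ _ /mapP[k _ ->] /mapP[l _ ->]; exact: cA.
exists W => // k; exists (fun i => (W *m A k *m W^t*) i i).
apply/(unitary_conj_eq _ _ hW).
suff diagA i j : i != j -> (W *m A k *m W^t*) i j = 0.
  apply/matrixP => i j; rewrite [RHS]mxE [X in X *+ _]mxE.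
  by have [<-|ij] := eqVneq i j; rewrite ?mulr1n// diagA.
move=> ij.
have base l : (l < N)%N -> (W *m A l *m W^t*) i j = 0.
  move=> lN; move/allP: trigA => /(_ (A l)) /=.
  rewrite map_f ?mem_iota// => /(_ isT); rewrite /similar_to conjymx//.
  set B := W *m A l *m W^t* => /is_trig_mxP trigB.
  have hB : B^t* = B by rewrite !adjmxM hA trmxCK mulmxA.
  (* the triangular form kills one side of the diagonal, symmetry the other *)
  case: (ltngtP i j) => [/trigB//|/trigB Bji|/val_inj eij]; last first.
    by rewrite eij eqxx in ij.
  by rewrite -hB mxE [X in X^*]mxE Bji conjC0.
have /submxP[D eD] := spanA k.
have -> : A k = \sum_l D 0 l *: A l.
  rewrite -(mxvecK (A k)) eD mulmx_sum_row linear_sum; apply: eq_bigr => l _.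
  by rewrite linearZ rowK /= mxvecK.
rewrite mulmx_sumr mulmx_suml summxE big1// => l _.
by rewrite -scalemxAr -scalemxAl mxE base ?mulr0.
Qed.
End Simultaneous.

(** * Convergence of matrices and of real powers *)

Section Limits.

Lemma cvg_mx (K : numFieldType) (m n : nat) (F : nat -> 'M[K]_(m, n))
    (L : 'M[K]_(m, n)) :
  F k @[k --> \oo] --> L <-> forall i j, F k i j @[k --> \oo] --> L i j.
Proof.
split=> [FL i j A LA|FL].
  have : nbhs L [set M : 'M[K]_(m, n) | A (M i j)].
    exists (fun i' j' => if (i' == i) && (j' == j) then A else setT).
      move=> i' j' /=.
      by case: ifP => [/andP[/eqP-> /eqP->]//|_]; exact: filterT.
    by move=> M /(_ i j); rewrite !eqxx.
  exact: FL.
move=> B [P LP sPB].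
suff : \forall k \near \oo, forall i j, P i j (F k i j).
  by apply: filterS => k Pk; exact: sPB.
apply: filter_forall => i; apply: filter_forall => j.
exact: (FL i j (P i j) (LP i j)).
Qed.

Lemma cvg_seq_sum (K : numFieldType) (I : Type) (s : seq I) (f : I -> nat -> K)
    (l : I -> K) :
  (forall i, f i k @[k --> \oo] --> l i) ->
  \sum_(i <- s) f i k @[k --> \oo] --> \sum_(i <- s) l i.
Proof.
move=> fl; elim: s => [|i s IH].
  by under eq_fun do rewrite big_nil; rewrite big_nil; exact: cvg_cst.
by under eq_fun do rewrite big_cons; rewrite big_cons; exact: cvgD.
Qed.

Lemma cvg_mulmx (K : numFieldType) (m n p : nat) (F : nat -> 'M[K]_(m, n))
    (G : nat -> 'M[K]_(n, p)) (A : 'M[K]_(m, n)) (B : 'M[K]_(n, p)) :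
  F k @[k --> \oo] --> A -> G k @[k --> \oo] --> B ->
  F k *m G k @[k --> \oo] --> A *m B.
Proof.
move=> /cvg_mx FA /cvg_mx GB; apply/cvg_mx => i j.
under eq_fun do rewrite mxE; rewrite mxE.
by apply: cvg_seq_sum => l; exact: cvgM.
Qed.

Variable R : realType.
Local Notation C := (Cplx R).

Lemma cvg_toC (x : nat -> R) (l : R) :
  x k @[k --> \oo] --> l -> toC (x k) @[k --> \oo] --> toC l.
Proof.
move=> xl; apply/cvgrPdist_lt => e /gt0_toC[d d0 ->].
move/cvgrPdist_lt: xl => /(_ d d0); apply: filterS => k.
by rewrite -rmorphB norm_toC ltr_toC.
Qed.

Lemma cvg_of_toC (x : nat -> R) (l : R) :
  toC (x k) @[k --> \oo] --> toC l -> x k @[k --> \oo] --> l.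
Proof.
move=> /cvgrPdist_lt xl; apply/cvgrPdist_lt => e e0.
have := xl (toC e); rewrite -[X in X < _](rmorph0 (@toC R)) ltr_toC => /(_ e0).
by apply: filterS => k; rewrite -rmorphB norm_toC ltr_toC.
Qed.

Lemma cvg_expC (z : C) : `|z| < 1 -> z ^+ k @[k --> \oo] --> (0 : C).
Proof.
move=> z1; pose t : R := complex.Re `|z|.
have tz : toC t = `|z| by rewrite /t -real_toC ?normr_real.
have t0 : 0 <= t by rewrite -ler_toC rmorph0 tz.
have t1 : `|t| < 1 by rewrite ger0_norm// -ltr_toC rmorph1 tz.
have /cvgrPdist_lt ht := cvg_expr t1.
apply/cvgrPdist_lt => e /gt0_toC[d d0 ->].
have := ht d d0; apply: filterS => k.
by rewrite !sub0r !normrN !normrX -tz (ger0_norm t0) -rmorphXn ltr_toC.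
Qed.

Lemma cvg_powR (p l : R) (x : nat -> R) : 0 < l ->
  x k @[k --> \oo] --> l -> x k `^ p @[k --> \oo] --> l `^ p.
Proof.
move=> l0 xl.
have /differentiable_continuous c : differentiable (powR (R := R) ^~ p) l.
  by apply/derivable1_diffP; apply: derivable_powR; rewrite in_itv/= andbT.
exact: (cvg_comp _ _ xl c).
Qed.

End Limits.

(** * Iterates of the transformation *)

Section AluthgeIterates.
Variables (R : realType) (m : nat).
Local Notation C := (Cplx R).
Implicit Types (U W V X Q P : 'M[C]_m) (d e q : 'I_m -> R).

(** The power mean is homogeneous: scaling by s gives the weighted power mean
    of s and t. *)
Lemma power_mean_kernel (r l s t : R) : r != 0 -> 0 < l < 1 -> 0 < s -> 0 < t ->
  s * power_mean_fun r l (t / s) = ((1 - l) * s `^ r + l * t `^ r) `^ r^-1.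
Proof.
move=> r0 /andP[l0 l1] s0 t0; rewrite /power_mean_fun.
have {1}-> : s = (s `^ r) `^ r^-1 by rewrite -powRrM divff// powRr1// ltW.
have l1' : 0 <= 1 - l by rewrite subr_ge0 ltW.
rewrite -powRM ?powR_ge0//; last first.
  by rewrite addr_ge0// mulr_ge0 ?powR_ge0// ltW.
congr (_ `^ _); rewrite mulrDr mulrC; congr (_ + _).
by rewrite mulrCA -powRM ?divr_ge0 ?ltW// [s * _]mulrC divfK ?gt_eqF.
Qed.

Lemma udiag_mull_entry U W d i j : W \is unitarymx ->
  (W *m (udiag W d *m U) *m W^t*) i j = toC (d i) * (W *m U *m W^t*) i j.
Proof.
move=> hW; rewrite mulmxA (cdiag_mull _ hW) -!mulmxA mul_diag_mx mxE.
by rewrite [X in X * _]mxE !mulmxA.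
Qed.

Lemma udiag_mulr_entry U W d i j : W \is unitarymx ->
  (W *m (U *m udiag W d) *m W^t*) i j = (W *m U *m W^t*) i j * toC (d j).
Proof.
move=> hW; rewrite -mulmxA -(mulmxA U) (cdiag_mulr _ hW) !mulmxA.
by rewrite mul_mx_diag mxE [X in _ * X]mxE.
Qed.

Lemma eq_unitary_conj W X Q : W \is unitarymx ->
  (forall i j, (W *m X *m W^t*) i j = (W *m Q *m W^t*) i j) -> X = Q.
Proof.
move=> hW eXQ.
have /(unitary_conj_eq _ _ hW) -> : W *m X *m W^t* = W *m Q *m W^t*.
  by apply/matrixP.
by apply/esym/(unitary_conj_eq _ _ hW).
Qed.

Lemma aluthge_arithmetic (l : R) U Q :
  0 < l < 1 -> U \is unitarymx -> posdef Q ->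
  aluthge (power_mean_fun 1 l) (U *m Q) =
  U *m conj_avg (toC (1 - l)) (toC l) U Q.
Proof.
move=> hl hU /posdef_udiagP[W [q [hW q0 ->]]].
apply: (eq_unitary_conj hW) => i j; rewrite (aluthge_schur _ hU hW q0) mxE.
rewrite power_mean_kernel ?oner_eq0// invr1.
rewrite (mulmx_conj_avg _ _ _ hU) sandwich_lin_entry.
rewrite [RHS](congr2 (fun x y => toC (1 - l) * x + toC l * y)
  (udiag_mull_entry U q i j hW) (udiag_mulr_entry U q i j hW)).
have h0 : 0 <= (1 - l) * q i `^ 1 + l * q j `^ 1.
  case/andP: hl => l0 l1.
  by rewrite addr_ge0// mulr_ge0 ?powR_ge0 ?subr_ge0 ?(ltW l0) ?(ltW l1).
rewrite (powRr1 h0) !powRr1 ?(ltW (q0 _))// rmorphD !rmorphM mulrDl.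
by congr (_ + _); rewrite -mulrA//; congr (_ * _); rewrite mulrC.
Qed.

(** Where the intertwining entry of U does not vanish the two eigenvalues
    agree, so the Schur kernel may be evaluated on the eigenvalues of U^t* Q U,
    which no longer depend on the row. *)
Lemma aluthge_commuting (f : R -> R) U W q q' :
  U \is unitarymx -> W \is unitarymx -> (forall i, 0 < q i) ->
  U^t* *m udiag W q *m U = udiag W q' ->
  aluthge f (U *m udiag W q) = U *m udiag W (fun j => q' j * f (q j / q' j)).
Proof.
move=> hU hW q0 eq'.
apply: (eq_unitary_conj hW) => i j; rewrite (aluthge_schur _ hU hW q0) mxE.
rewrite [RHS](udiag_mulr_entry _ _ _ _ hW).
have intertwine : (W *m (udiag W q *m U) *m W^t*) i j =
    (W *m (U *m udiag W q') *m W^t*) i j.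
  by rewrite -eq' !(mulmxA U) (unitary_mulV hU) mul1mx.
have := etrans (esym (udiag_mull_entry U q i j hW))
  (etrans intertwine (udiag_mulr_entry U q' i j hW)).
set M := (W *m U *m W^t*) i j.
have [->|M0] := eqVneq M 0; first by rewrite !mulr0 !mul0r.
rewrite mulrC => /(mulfI M0)/(can_inj (@toCK R)) ->.
by rewrite mulrC.
Qed.

(** The invariant of the iteration. Diagonality of X and U^t* X U alone would
    not suffice: each step of the averaging consumes one conjugation by U. *)
Definition jointly_diagonal W U X :=
  forall k, exists d, U^t* ^+ k *m X *m U ^+ k = udiag W d.

Lemma jointly_diagonal_conj_avg (c1 c2 : R) W U X : jointly_diagonal W U X ->
  jointly_diagonal W U (conj_avg (toC c1) (toC c2) U X).
Proof.
move=> jX k; have [d ed] := jX k; have [e ee] := jX k.+1.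
exists (fun i => c1 * e i + c2 * d i).
have -> : U^t* ^+ k *m conj_avg (toC c1) (toC c2) U X *m U ^+ k =
    toC c1 *: (U^t* ^+ k.+1 *m X *m U ^+ k.+1) +
    toC c2 *: (U^t* ^+ k *m X *m U ^+ k).
  rewrite /conj_avg mulmxDr mulmxDl -!scalemxAr -!scalemxAl exprSr exprS.
  by rewrite -![_ * _]/(_ *m _) !mulmxA.
rewrite ed ee /udiag !cdiagZ cdiagD; apply: eq_cdiag => i.
by rewrite [RHS]rmorphD !rmorphM.
Qed.

Lemma jointly_diagonal_iter (c1 c2 : R) W U X n : jointly_diagonal W U X ->
  jointly_diagonal W U (iter n (conj_avg (toC c1) (toC c2) U) X).
Proof.
move=> jX; elim: n => [//|n IH]; rewrite iterS.
exact: jointly_diagonal_conj_avg.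
Qed.

Lemma jointly_diagonal0 W U X :
  jointly_diagonal W U X -> exists d, X = udiag W d.
Proof.
by move=> /(_ 0%N)[d]; rewrite !expr0 mul1mx mulmx1 => ->; exists d.
Qed.

(** On r-th powers of moduli the transformation is the linear averaging, since
    the new eigenvalues are power means of those of Q and of U^t* Q U. *)
Lemma aluthge_power_mean (r l : R) W U X : r != 0 -> 0 < l < 1 ->
  U \is unitarymx -> W \is unitarymx -> posdef X -> jointly_diagonal W U X ->
  aluthge (power_mean_fun r l) (U *m mxpow X r^-1) =
  U *m mxpow (conj_avg (toC (1 - l)) (toC l) U X) r^-1.
Proof.
move=> r0 hl hU hW pX jX.
have [d ed] := jointly_diagonal0 jX; have [e ee] := jX 1%N.
rewrite !expr1 in ee.
have pd : posdef (udiag W d) by rewrite -ed.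
have pe : posdef (udiag W e).
  by rewrite -ee; apply: posdef_congr => //; exact: unitarymx_unit.
have d0 := posdef_udiag_gt0 pd hW; have e0 := posdef_udiag_gt0 pe hW.
have eQ : mxpow X r^-1 = udiag W (fun i => d i `^ r^-1).
  by rewrite ed; exact: mxpow_udiag.
have eQ' : U^t* *m udiag W (fun i => d i `^ r^-1) *m U =
    udiag W (fun i => e i `^ r^-1).
  rewrite -eQ -(mxfun_conj _ hU); last by case: pX.
  by rewrite ee; exact: mxpow_udiag.
rewrite eQ (aluthge_commuting _ hU hW _ eQ'); last by move=> i; exact: powR_gt0.
congr (_ *m _).
have -> : conj_avg (toC (1 - l)) (toC l) U X =
    udiag W (fun i => (1 - l) * e i + l * d i).
  rewrite /conj_avg ee ed /udiag !cdiagZ cdiagD; apply: eq_cdiag => i.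
  by rewrite [RHS]rmorphD !rmorphM.
rewrite (mxpow_udiag _ _ hW); apply: eq_udiag => i.
rewrite power_mean_kernel ?powR_gt0//.
by rewrite -!powRrM mulVf// !powRr1// ltW.
Qed.

Lemma posdef_iter_conj_avg (l : R) U X n : 0 < l < 1 -> U \is unitarymx ->
  posdef X -> posdef (iter n (conj_avg (toC (1 - l)) (toC l) U) X).
Proof.
move=> /andP[l0 l1] hU pX; elim: n => [//|n IH]; rewrite iterS.
by apply: posdef_conj_avg; rewrite // -(rmorph0 (@toC R)) ltr_toC ?subr_gt0.
Qed.

Lemma aluthge_iter_centered (r l : R) W U P n : r != 0 -> 0 < l < 1 ->
  U \is unitarymx -> W \is unitarymx -> posdef P ->
  jointly_diagonal W U (mxpow P r) ->
  aluthge_iter (power_mean_fun r l) n (U *m P) =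
  U *m mxpow (iter n (conj_avg (toC (1 - l)) (toC l) U) (mxpow P r)) r^-1.
Proof.
move=> r0 hl hU hW pP jP; elim: n => [|n IH]; first by rewrite /= mxpowK.
rewrite /aluthge_iter !iterS -/(aluthge_iter _ _ _) IH.
apply: (aluthge_power_mean r0 hl hU hW).
  exact: (posdef_iter_conj_avg _ hl hU (posdef_mxpow r pP)).
exact: jointly_diagonal_iter.
Qed.

Lemma aluthge_iter_arithmetic (l : R) U P n : 0 < l < 1 -> U \is unitarymx ->
  posdef P ->
  aluthge_iter (power_mean_fun 1 l) n (U *m P) =
  U *m iter n (conj_avg (toC (1 - l)) (toC l) U) P.
Proof.
move=> hl hU pP; elim: n => [//|n IH].
rewrite /aluthge_iter !iterS -/(aluthge_iter _ _ _) IH.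
exact: (aluthge_arithmetic hl hU (posdef_iter_conj_avg n hl hU pP)).
Qed.

(** The common eigenbasis of all U^t*^k P U^k also diagonalizes their r-th
    powers, which are the conjugates of the r-th power of P. *)
Lemma centered_jointly_diagonal (r : R) U P : U \is unitarymx -> posdef P ->
  centered (U *m P) ->
  exists2 W, W \is unitarymx & jointly_diagonal W U (mxpow P r).
Proof.
move=> hU pP cT; pose A k := U^t* ^+ k *m P *m U ^+ k.
have eA k : A k = (U ^+ k)^t* *m P *m U ^+ k by rewrite adjmxX.
have pA k : posdef (A k).
  by rewrite eA; apply: posdef_congr => //; exact/unitarymx_unit/unitary_expr.
have famA k : centered_family (U *m P) (A k).
  rewrite /centered_family (mxabs_mul_unitary hU pP).
  rewrite (polar_factor_mul_unitary hU pP).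
  case: k => [|k]; last by left; right; exists k.+1.
  by left; left; rewrite /A !expr0 mul1mx mulmx1.
have [k|k l|W hW dA] := simultaneous_diag (A := A).
- by case: (pA k).
- exact: cT.
exists W => // k; have [a ea] := dA k.
have a0 := posdef_cdiag_gt0 (a := a) (W := W).
rewrite -ea in a0; have {}a0 := a0 (pA k) hW.
exists (fun i => complex.Re (a i) `^ r).
rewrite -adjmxX -mxfun_conj; last 2 first.
- exact: unitary_expr.
- by case: pP.
rewrite -eA ea.
have -> : cdiag W a = udiag W (fun i => complex.Re (a i)).
  by apply: eq_cdiag => i; apply/real_toC/gtr0_real.
exact: mxpow_udiag.
Qed.

End AluthgeIterates.

(** * Limit of the iterates *)

Section AluthgeLimit.
Variables (R : realType) (m : nat).
Local Notation C := (Cplx R).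
Implicit Types (U W V X Q P : 'M[C]_m).

Lemma hadamard1 X : hadamard 1%:M X = diag_mx (\row_i X i i).
Proof.
apply/matrixP => i j; rewrite !mxE.
by have [<-|_] := eqVneq i j; rewrite ?mul1r ?mul0r.
Qed.

(** In the eigenbasis of U the diagonal entries are fixed and the others are
    multiplied at each step by a number of modulus less than 1. *)
Lemma cvg_conj_avg (l : R) U V X (alpha : 'rV[C]_m) : 0 < l < 1 ->
  U \is unitarymx -> V \is unitarymx -> U = V^t* *m diag_mx alpha *m V ->
  (forall i j, i != j -> alpha 0 i != alpha 0 j) ->
  iter n (conj_avg (toC (1 - l)) (toC l) U) X @[n --> \oo] -->
  V^t* *m hadamard 1%:M (V *m X *m V^t*) *m V.
Proof.
move=> /andP[l0 l1] hU hV eU ha; set F := conj_avg _ _ U.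
have eF n : V^t* *m (V *m iter n F X *m V^t*) *m V = iter n F X.
  by apply/esym/(unitary_conj_eq _ _ hV).
under eq_fun do rewrite -eF.
apply: cvg_mulmx; last exact: cvg_cst.
apply: cvg_mulmx; first exact: cvg_cst.
apply/cvg_mx => i j; under eq_fun do rewrite (conj_avg_entry _ _ _ _ _ _ hV eU).
have n1 k : `|alpha 0 k| = 1 by exact: (unitary_diag_norm1 _ hU hV eU).
rewrite hadamard1 mxE [X in X *+ _]mxE.
have [<-|ij] := eqVneq i j.
  have -> : toC (1 - l) * ((alpha 0 i)^* * alpha 0 i) + toC l = 1.
    by rewrite mulrC (mulrC _^*) -normCK n1 expr1n mul1r -rmorphD subrK rmorph1.
  by under eq_fun do rewrite expr1n mul1r; exact: cvg_cst.
rewrite mulr0n -(mul0r ((V *m X *m V^t*) i j)).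
apply: cvgM; last exact: cvg_cst.
apply: cvg_expC; rewrite rmorphB rmorph1; apply: norm_conj_avg_lt1 => //.
  by rewrite -(rmorph0 (@toC R)) -(rmorph1 (@toC R)) !ltr_toC l0.
exact: ha.
Qed.

(** The diagonal entries of a positive definite matrix are positive; this keeps
    the limit away from the singularity of negative powers at 0. *)
Lemma posdef_hadamard1 V X : V \is unitarymx -> posdef X ->
  posdef (V^t* *m hadamard 1%:M (V *m X *m V^t*) *m V).
Proof.
move=> hV pX.
have -> : V^t* *m hadamard 1%:M (V *m X *m V^t*) *m V =
    cdiag V (fun i => (V *m X *m V^t*) i i).
  by rewrite hadamard1.
by apply: posdef_cdiag => // i; exact: posdef_entry.
Qed.

(** The limit is diagonal in the common eigenbasis, so the functional calculus
    converges because p-th powers do at its positive diagonal entries. *)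
Lemma cvg_mxpow_udiag (p : R) W (X : nat -> 'M[C]_m) (L : 'M[C]_m) :
  W \is unitarymx -> posdef L -> (forall n, exists d, X n = udiag W d) ->
  X n @[n --> \oo] --> L -> mxpow (X n) p @[n --> \oo] --> mxpow L p.
Proof.
move=> hW pL /choice[e eX] XL.
have eL : udiag W (e n) @[n --> \oo] --> L.
  by have -> : (fun n => udiag W (e n)) = X by apply/funext => n; rewrite eX.
have entry i j : toC (e n i) *+ (i == j) @[n --> \oo] -->
    (W *m L *m W^t*) i j.
  have : W *m udiag W (e n) *m W^t* @[n --> \oo] --> W *m L *m W^t*.
    apply: cvg_mulmx; last exact: cvg_cst.
    by apply: cvg_mulmx; [exact: cvg_cst | exact: eL].
  move/cvg_mx => /(_ i j).
  by under eq_fun do rewrite (cdiag_entry _ _ _ hW).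
have [l eWL] : exists l, L = udiag W l.
  exists (fun i => complex.Re ((W *m L *m W^t*) i i)).
  apply/(unitary_conj_eq _ _ hW)/matrixP => i j.
  rewrite [RHS]mxE [X in X *+ _]mxE.
  have [<-|ij] := eqVneq i j.
    by rewrite mulr1n; apply/real_toC/gtr0_real/posdef_entry.
  have := entry i j; rewrite (negPf ij) => /cvg_lim <- //.
  by apply: cvg_lim => //; exact: cvg_cst.
rewrite eWL in pL entry *; have l0 := posdef_udiag_gt0 pL hW.
have el i : e n i @[n --> \oo] --> l i.
  by apply: cvg_of_toC; have := entry i i; rewrite (cdiag_entry _ _ _ hW) eqxx.
have -> : (fun n => mxpow (X n) p) = (fun n => udiag W (fun i => e n i `^ p)).
  by apply/funext => n; rewrite eX; exact: mxpow_udiag.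
rewrite (mxpow_udiag l p hW).
apply: cvg_mulmx; last exact: cvg_cst.
apply: cvg_mulmx; first exact: cvg_cst.
apply/cvg_mx => i j; under eq_fun do rewrite mxE mxE; rewrite mxE mxE.
have [_|_] := eqVneq i j; last exact: cvg_cst.
by apply: cvg_toC; apply: cvg_powR.
Qed.

Lemma cvg_aluthge_centered (r l : R) U V P (alpha : 'rV[C]_m) :
  r != 0 -> 0 < l < 1 -> posdef P ->
  U \is unitarymx -> V \is unitarymx -> U = V^t* *m diag_mx alpha *m V ->
  (forall i j, i != j -> alpha 0 i != alpha 0 j) ->
  centered (U *m P) ->
  aluthge_iter (power_mean_fun r l) n (U *m P) @[n --> \oo] -->
  U *m mxpow (V^t* *m hadamard 1%:M (V *m mxpow P r *m V^t*) *m V) r^-1.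
Proof.
move=> r0 hl pP hU hV eU ha cT.
have [W hW jW] := centered_jointly_diagonal r hU pP cT.
have pPr : posdef (mxpow P r) := posdef_mxpow r pP.
under eq_fun do rewrite (aluthge_iter_centered _ r0 hl hU hW pP jW).
apply: cvg_mulmx; first exact: cvg_cst.
apply: (cvg_mxpow_udiag hW (posdef_hadamard1 hV pPr)).
  by move=> n; exact: (jointly_diagonal0 (jointly_diagonal_iter _ _ n jW)).
exact: (cvg_conj_avg hl hU hV eU ha).
Qed.

Lemma cvg_aluthge_arithmetic (l : R) U V P (alpha : 'rV[C]_m) :
  0 < l < 1 -> posdef P ->
  U \is unitarymx -> V \is unitarymx -> U = V^t* *m diag_mx alpha *m V ->
  (forall i j, i != j -> alpha 0 i != alpha 0 j) ->
  aluthge_iter (power_mean_fun 1 l) n (U *m P) @[n --> \oo] -->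
  U *m (V^t* *m hadamard 1%:M (V *m P *m V^t*) *m V).
Proof.
move=> hl pP hU hV eU ha.
under eq_fun do rewrite (aluthge_iter_arithmetic _ hl hU pP).
apply: cvg_mulmx; first exact: cvg_cst.
exact: (cvg_conj_avg hl hU hV eU ha).
Qed.

End AluthgeLimit.

Theorem corollary8p2 (R : realType) (m : nat) (lambda r : R)
    (T U V : 'M[Cplx R]_m) (alpha : 'rV[Cplx R]_m)
    (hlambda : 0 < lambda < 1)
    (hr : -1 <= r <= 1) (hr0 : r != 0)
    (hT : T \in unitmx)
    (hU : U \is unitarymx) (hTU : T = U *m mxabs T)
    (hV : V \is unitarymx)
    (hUV : U = V^t* *m diag_mx alpha *m V)
    (halpha : forall i j : 'I_m, i != j -> alpha 0 i != alpha 0 j)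
    (hcentered : centered T \/ r = 1) :
  (fun n : nat => aluthge_iter (power_mean_fun r lambda) n T) @ \oo -->
    U *m mxpow
      (V^t* *m hadamard 1%:M (V *m mxpow (mxabs T) r *m V^t*) *m V) r^-1.
Proof.
move: (posdef_mxabs hT) hTU hcentered; move: (mxabs T) => P pP -> [cT|r1].
  exact: (cvg_aluthge_centered hr0 hlambda pP hU hV hUV halpha cT).
rewrite r1 invr1 (mxpow1 pP) mxpow1; last exact: posdef_hadamard1.
exact: (cvg_aluthge_arithmetic hlambda pP hU hV hUV halpha).
Qed.
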